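(* Let $(r_1, r_2, \ldots)$ be a nondecreasing and unbounded sequence of positive integers greater than $1$, let $X_i=\{1,2,\ldots,r_i\}$ for $i\ge 1$ and $X=(X_1,X_2,\ldots)$. Let $A=(X,Q,\varphi^A,\psi^A)$ be the automaton over the changing alphabet $X$ with set of states $Q=\{a,b\}$ and with transition functions $\varphi^A_i\colon Q\times X_i\to Q$ and output functions $\psi^A_i\colon Q\times X_i\to X_i$ ($i\geq 1$) given by $$\varphi^A_i(q,x)=\begin{cases} a, & x=1,\ q=b,\\ b, & x=1,\ q=a,\\ q, & x\neq 1,\end{cases}\qquad \psi^A_i(q,x)=\begin{cases}\sigma_i(x), & q=a,\\ \tau_i(x), & q=b,\end{cases}$$ where $\tau_i$ is the transposition $(1,2)$ and $\sigma_i$ is the $r_i$-cycle $(1,2,\ldots,r_i)$ in the symmetric group of $X_i$. Then the group $G(A)$ generated by the automaton functions $A_{1,a}$ and $A_{1,b}$ is a free group of rank $2$, generated freely by $A_{1,a}$ and $A_{1,b}$.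
   Context: A changing alphabet is an infinite sequence $X=(X_1,X_2,\ldots)$ of finite nonempty sets. $X^*_{(1)}$ denotes the set of all finite words $x_1x_2\ldots x_m$ ($m\ge 1$) with $x_j\in X_j$ for $1\le j\le m$, together with the empty word $\emptyset$. An automaton $A=(X,Q,\varphi,\psi)$ over $X$ is a set $Q$ (of states) with sequences $\varphi=(\varphi_1,\varphi_2,\ldots)$, $\psi=(\psi_1,\psi_2,\ldots)$ of transition functions $\varphi_i\colon Q\times X_i\to Q$ and output functions $\psi_i\colon Q\times X_i\to X_i$. For $q\in Q$ the automaton function $A_{1,q}\colon X^*_{(1)}\to X^*_{(1)}$ is defined by $A_{1,q}(\emptyset)=\emptyset$ and $$A_{1,q}(x_1x_2\ldots x_m)=\psi_1(q_1,x_1)\psi_2(q_2,x_2)\ldots\psi_m(q_m,x_m),$$ where $q_1=q$ and $q_{j+1}=\varphi_j(q_j,x_j)$ for $1\le j<m$. The automaton is invertible if for all $i\ge1$ and $q\in Q$ the map $x\mapsto\psi_i(q,x)$ is a bijection of $X_i$; in that case all $A_{1,q}$ are bijections of $X^*_{(1)}$, and $G(A)$ is the group generated by $\{A_{1,q}\colon q\in Q\}$ under composition. The automaton in the claim is invertible. *)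

(* Defs.v *)
From HB Require Import structures.
From mathcomp Require Import all_boot fingroup perm.
From mathcomp Require Import boolp classical_sets.

Set Implicit Arguments.
Unset Strict Implicit.
Unset Printing Implicit Defensive.

Local Open Scope classical_set_scope.
Local Open Scope group_scope.

(* The symmetric group of an arbitrary, possibly infinite, type; by proof
   irrelevance its elements are determined by their underlying functions. *)
Record sym (T : Type) := Sym { sym_fun :> T -> T; sym_bij : bijective sym_fun }.

HB.instance Definition _ (T : Type) := gen_eqMixin (sym T).
HB.instance Definition _ (T : Type) := gen_choiceMixin (sym T).

Section SymGroup.
Variable T : Type.
Implicit Types f g h : sym T.

Lemma symP f g : f =1 g -> f = g.
Proof.
case: f g => f fb [g gb] /= /funext fg; move: gb; rewrite -fg => gb.
by congr Sym; exact: Prop_irrelevance.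
Qed.

Lemma sym_inv_ex f : exists g : T -> T, cancel f g /\ cancel g f.
Proof. by case: f => f [g fK gK]; exists g. Qed.

Definition sym_one : sym T := Sym (@inv_bij T id (fun=> erefl)).
Definition sym_mul f g : sym T := Sym (bij_comp (sym_bij f) (sym_bij g)).
Definition sym_inv f : sym T :=
  let: exist g (conj fK gK) := cid (sym_inv_ex f) in Sym (Bijective gK fK).

Lemma sym_mulA : associative sym_mul. Proof. by move=> f g h; exact: symP. Qed.
Lemma sym_mul1 : left_id sym_one sym_mul. Proof. by move=> f; exact: symP. Qed.
Lemma sym_mulr1 : right_id sym_one sym_mul.
Proof. by move=> f; exact: symP. Qed.

Lemma sym_mulV : left_inverse sym_one sym_inv sym_mul.
Proof.
move=> f; rewrite /sym_inv; case: cid => g [fK gK].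
by apply: symP => x /=; rewrite fK.
Qed.

Lemma sym_mulrV : right_inverse sym_one sym_inv sym_mul.
Proof.
move=> f; rewrite /sym_inv; case: cid => g [fK gK].
by apply: symP => x /=; rewrite gK.
Qed.

End SymGroup.

HB.instance Definition _ (T : Type) := isGroup.Build (sym T)
  (@sym_mulA T) (@sym_mul1 T) (@sym_mulr1 T) (@sym_mulV T) (@sym_mulrV T).

Section GeneratedGroup.
Variables (G : groupType) (I : Type) (g : I -> G).

Definition generated : set G :=
  smallest [set M : set G | group_closed (mem M)] (range g).

Lemma generated_group_closed : group_closed (mem generated).
Proof.
split; first by apply/mem_set => M [[M1 _] _]; exact: set_mem M1.
move=> x y /set_mem gx /set_mem gy; apply/mem_set => M MP.
case: (MP) => -[_ Md] _; apply: set_mem; apply: Md; apply/mem_set.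
  exact: gx.
exact: gy.
Qed.

Lemma generated_gen i : g i \in mem generated.
Proof. by apply/mem_set; apply: sub_gen_smallest; exists i. Qed.

Record gen_group := GenGroup { gen_val :> G; _ : gen_val \in mem generated }.

HB.instance Definition _ := [isSub for gen_val].
HB.instance Definition _ := [Choice of gen_group by <:].
HB.instance Definition _ :=
  SubChoice_isSubGroup.Build G (mem generated) gen_group generated_group_closed.

Definition gen_elt (i : I) : gen_group := GenGroup (generated_gen i).

End GeneratedGroup.

(* Universal property of a free group on the family [g]; uniqueness of the
   extension amounts to [g] generating [G]. *)
Definition freely_generated (I : Type) (G : groupType) (g : I -> G) : Prop :=
  forall (H : groupType) (f : I -> H),
    exists2 phi : {multiplicative G -> H}, (forall i, phi (g i) = f i)
      & forall psi : {multiplicative G -> H},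
          (forall i, psi (g i) = f i) -> psi =1 phi.

Definition free_group_of_rank (n : nat) (G : groupType) : Prop :=
  exists g : 'I_n -> G, freely_generated g.

Local Open Scope nat_scope.

(* Sequences are indexed from 0: the index [i : nat] stands for position i + 1,
   so [X 0], [trans A 0], [out A 0] are X_1, phi_1, psi_1. *)
Record alphabet := Alphabet {
  letter :> nat -> finType;
  letter_nonempty : forall i, 0 < #|letter i| }.

(* [word X k] is the set of finite (possibly empty) words whose j-th letter
   lies in [X (k + j)], j = 0, 1, ...; thus [word X 0] is X^*_(1). *)
Inductive word (X : alphabet) : nat -> Type :=
| wnil k : word X k
| wcons k : X k -> word X k.+1 -> word X k.

Record automaton (X : alphabet) (Q : Type) := Automaton {
  trans : forall i, Q -> X i -> Q;
  out : forall i, Q -> X i -> X i }.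

Section AutomatonGroup.
Variables (X : alphabet) (Q : Type) (A : automaton X Q).

Fixpoint aut_fun k (q : Q) (w : word X k) : word X k :=
  match w with
  | wnil k => wnil X k
  | wcons k x w' => wcons (out A q x) (aut_fun (trans A q x) w')
  end.

Definition invertible : Prop := forall i q, bijective (@out X Q A i q).

Hypothesis invA : invertible.

Lemma aut_fun_bij k q : bijective (@aut_fun k q).
Proof.
have inv_ex i p : exists g : X i -> X i,
    cancel (@out X Q A i p) g /\ cancel g (@out X Q A i p).
  by case: (invA i p) => g gK Kg; exists g.
pose oinv i p : X i -> X i := sval (cid (inv_ex i p)).
have oinvK i p : cancel (@out X Q A i p) (oinv i p).
  by rewrite /oinv; case: cid => g [].
have oinvVK i p : cancel (oinv i p) (@out X Q A i p).
  by rewrite /oinv; case: cid => g [].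
pose F := fix F k (p : Q) (w : word X k) : word X k :=
  match w with
  | wnil k => wnil X k
  | wcons k x w' => wcons (oinv k p x) (F k.+1 (trans A p (oinv k p x)) w')
  end.
exists (F k q).
- by move=> w; elim: w q => //= {}k x w IHw q; rewrite oinvK IHw.
- by move=> w; elim: w q => //= {}k x w IHw q; rewrite oinvVK IHw.
Qed.

Definition aut_sym (q : Q) : sym (word X 0) := Sym (aut_fun_bij 0 q).

(* The group G(A) and its generators A_{1,q}; the product is [f \o g]. *)
Definition aut_group : groupType := gen_group aut_sym.
Definition aut_gen (q : Q) : aut_group := gen_elt aut_sym q.

End AutomatonGroup.

Inductive state := state_a | state_b.

Section TheAutomaton.
Variables (r : nat -> nat) (r_gt1 : forall i, 1 < r i).

Lemma letter_ord_nonempty i : 0 < #|'I_(r i)|.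
Proof. by rewrite card_ord ltnW. Qed.

(* The letter x in {1, ..., r_i} is encoded by the ordinal x - 1. *)
Definition ord_alphabet : alphabet :=
  @Alphabet (fun i => 'I_(r i)) letter_ord_nonempty.

Definition letter1 i : 'I_(r i) := Ordinal (ltnW (r_gt1 i)).
Definition letter2 i : 'I_(r i) := Ordinal (r_gt1 i).

(* [ordS] is x |-> x + 1 modulo [r i]. *)
Definition sigma i : {perm 'I_(r i)} := perm (@ordS_inj (r i)).
Definition tau i : {perm 'I_(r i)} := tperm (letter1 i) (letter2 i).

Definition trans_ab i (q : state) (x : 'I_(r i)) : state :=
  if x == letter1 i then
    match q with state_a => state_b | state_b => state_a end
  else q.

Definition out_ab i (q : state) (x : 'I_(r i)) : 'I_(r i) :=
  match q with state_a => sigma i x | state_b => tau i x end.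

Definition automaton_ab : automaton ord_alphabet state :=
  @Automaton ord_alphabet state trans_ab out_ab.

Lemma automaton_ab_invertible : invertible automaton_ab.
Proof. by move=> i [] /=; apply: injF_bij; exact: perm_inj. Qed.

End TheAutomaton.

(* Main.v *)
(* Passing a letter x through a group word W = s_n^(e_n) ... s_1^(e_1) in a, b
   replaces W by its section at x, a word with the same signs e_j.  A generator
   with sign + (resp. -) is exchanged with the other one exactly when the current
   letter is the first (resp. second) of the alphabet; hence sections of reduced
   words are reduced.
   For fixed signs and large r_i, the iterated sections of one reduced word
   exhaust all reduced words.  By induction on the length, one only has to
   exchange the last generator when the last two signs agree.  Say they are +,
   and let x be K steps below the first letter (cyclically), where K counts the
   signs + of the prefix.  Only one prefix S carries x to the first letter: a at
   the signs +, b^-1 at the signs -.  So along the first return of S to itself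
   under sections at x, the last generator is exchanged exactly once.
   If W were trivial, all its sections would be; but the word with a at the signs
   + and b^-1 at the signs - shifts letters far from the first two by the number
   of signs + (and symmetrically if all signs are -). *)

From HB Require Import structures.
Require Import Defs.
From mathcomp Require Import all_boot fingroup perm order ssralg ssrnum ssrint.
From mathcomp Require Import zify boolp classical_sets.

Set Implicit Arguments.
Unset Strict Implicit.
Unset Printing Implicit Defensive.

(** * Reduced words and their sections in the dual automaton *)

Definition reduced (I : eqType) (W : seq (bool * I)) :=
  sorted (fun l m => (l.2 == m.2) ==> (l.1 == m.1)) W.

(* A letter [(e, q)] of [W] is the generator a ([q = false]) or b ([q = true]) if
   [e] is [true], and its inverse otherwise.  [dual_act x W] is the section of [W]
   at the letter [x], [dual_run x W] the image of [x] under [W]; [z] and [o] stand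
   for the first two letters of the alphabet. *)
Section DualAutomaton.
Variables (P : eqType) (mv : bool -> bool -> P -> P) (z o : P).
Hypothesis mvK : forall e q, cancel (mv e q) (mv (~~ e) q).
Hypothesis mv_zo : forall q, mv true q z = o.
Implicit Types (x : P) (l : bool * bool) (W : seq (bool * bool)).

Definition flips (e : bool) x := x == if e then z else o.

Fixpoint dual_act x W :=
  if W is l :: W' then
    (l.1, l.2 (+) flips l.1 x) :: dual_act (mv l.1 l.2 x) W'
  else [::].

Fixpoint dual_run x W :=
  if W is l :: W' then dual_run (mv l.1 l.2 x) W' else x.

Definition dual_acts xs W := foldl (fun W x => dual_act x W) W xs.

Lemma dual_act_signs x W : map fst (dual_act x W) = map fst W.
Proof. by elim: W x => //= l W IHW x; rewrite IHW. Qed.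

Lemma dual_act_size x W : size (dual_act x W) = size W.
Proof. by rewrite -(size_map fst) dual_act_signs size_map. Qed.

Lemma dual_act_rcons x W l :
  dual_act x (rcons W l) =
  rcons (dual_act x W) (l.1, l.2 (+) flips l.1 (dual_run x W)).
Proof. by elim: W x => //= k W IHW x; rewrite IHW. Qed.

Lemma dual_act_inj x : injective (dual_act x).
Proof.
move=> W V; elim: W V x => [|[e q] W IHW] [|[d p] V] x //= [].
by move=> <- /addIb<- /IHW<-.
Qed.

(* The sections of an adjacent pair such as a b^-1 flip together, because
   both generators map [z] to [o]. *)
Lemma dual_act_reduced x W : reduced W -> reduced (dual_act x W).
Proof.
case: W x => //= l W x; elim: W l x => //= m W IHW l x /andP[lm redW].
rewrite IHW // andbT; case: l m lm {IHW redW} => e q [d p] /=.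
case: (eqVneq e d) => [-> | ed]; first by rewrite !implybT.
rewrite !implybF => qp; suff -> : flips d (mv e q x) = flips e x.
  by apply: contra qp => /eqP/addIb->.
have mvI c : injective (mv c q) := can_inj (mvK c q).
rewrite /flips; case: e d ed => [] [] // _; first by rewrite -(mv_zo q) inj_eq.
by rewrite -(inj_eq (mvI true)) (mvK false) mv_zo.
Qed.

Lemma dual_acts_signs xs W : map fst (dual_acts xs W) = map fst W.
Proof. by elim: xs W => //= x xs IHxs W; rewrite IHxs dual_act_signs. Qed.

Lemma dual_acts_reduced xs W : reduced W -> reduced (dual_acts xs W).
Proof. by elim: xs W => //= x xs IHxs W /(dual_act_reduced x)/IHxs. Qed.

Lemma dual_acts_cat xs ys W :
  dual_acts (xs ++ ys) W = dual_acts ys (dual_acts xs W).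
Proof. exact: foldl_cat. Qed.

Lemma dual_acts_nseq n x W : dual_acts (nseq n x) W = iter n (dual_act x) W.
Proof. by elim: n W => //= n IHn W; rewrite IHn -iterSr. Qed.

(** The letter reaching the last position depends on the prefix only, so one flip [c] serves both
    values of [q]. *)
Lemma dual_acts_rcons xs W (e : bool) :
  exists c, forall q,
    dual_acts xs (rcons W (e, q)) = rcons (dual_acts xs W) (e, q (+) c).
Proof.
elim: xs W => [|x xs IHxs] W /=; first by exists false => q; rewrite addbF.
have [c Wc] := IHxs (dual_act x W).
exists (flips e (dual_run x W) (+) c) => q.
by rewrite dual_act_rcons Wc /= addbA.
Qed.

(** Being injective, [dual_act x] permutes the finite set of words of one length. *)
Lemma dual_act_periodic x W : exists n, iter n.+1 (dual_act x) W = W.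
Proof.
pose F (t : (size W).-tuple (bool * bool)) : (size W).-tuple (bool * bool) :=
  tcast (etrans (dual_act_size x t) (size_tuple t)) (in_tuple (dual_act x t)).
have FE t : F t = dual_act x t :> seq _ by rewrite val_tcast.
have Finj : injective F.
  by move=> s t /(congr1 val) /=; rewrite !FE => /dual_act_inj; exact: val_inj.
have := iter_order Finj (in_tuple W); 
case: fingraph.order (fingraph.order_gt0 F (in_tuple W)).
  by [].
move=> n _ /(congr1 val) FW; exists n; rewrite -[RHS]FW.
by elim: n.+1 => // m IHm; rewrite !iterS IHm; exact/esym/FE.
Qed.

(* Along the first return of [W] to itself under [dual_act x], a final letter
   of sign [e] is flipped only at the step which starts from [W]. *)
Lemma dual_loop x W (e : bool) :
    (forall V, map fst V = map fst W ->
      flips e (dual_run x V) = (V == W)) ->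
  exists n, forall q,
    dual_acts (nseq n x) (rcons W (e, q)) = rcons W (e, ~~ q).
Proof.
move=> flipsW.
have /ex_minnP[n /eqP nW minn] : exists n, iter n.+1 (dual_act x) W == W.
  by have [n nW] := dual_act_periodic x W; exists n; rewrite nW.
have signs m : map fst (iter m (dual_act x) W) = map fst W.
  by rewrite -dual_acts_nseq dual_acts_signs.
exists n.+1 => q; rewrite dual_acts_nseq -{2}nW.
suff {nW} : forall m, m <= n -> iter m.+1 (dual_act x) (rcons W (e, q)) =
    rcons (iter m.+1 (dual_act x) W) (e, ~~ q) by apply.
elim=> [_ | m IHm mn].
  by rewrite /= dual_act_rcons /= flipsW // eqxx addbT.
rewrite iterS IHm 1?ltnW // dual_act_rcons /= flipsW; last exact: (signs m.+1).
case: eqP => [/eqP /minn | _]; first by rewrite leqNgt mn.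
by rewrite addbF.
Qed.

End DualAutomaton.

(** [ok x n] grants room for [n] more letters: [h] has to respect the moves only while room is
    left. *)
Lemma dual_act_morph (P P' : eqType) mv mv' (z o : P) (z' o' : P')
    (ok : P -> nat -> bool) (h : P -> P') :
    (forall x n e, ok x n.+1 -> flips z' o' e (h x) = flips z o e x) ->
    (forall x n e q, ok x n.+1 -> mv' e q (h x) = h (mv e q x)) ->
    (forall x n e q, ok x n.+1 -> ok (mv e q x) n) ->
  forall x W, ok x (size W) ->
    dual_act mv' z' o' (h x) W = dual_act mv z o x W /\
    dual_run mv' (h x) W = h (dual_run mv x W).
Proof.
move=> hflips hmv okmv x W; elim: W x => //= l W IHW x okx.
rewrite (hflips _ _ _ okx) (hmv _ _ _ _ okx).
by have [|-> ->] := IHW (mv l.1 l.2 x); first exact: okmv.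
Qed.

(** * The dual automaton on the integers *)

Import Order.TTheory GRing.Theory Num.Theory.

(** Model of a large alphabet: the cycle becomes the translation by 1, and 0 and 1 are the first two
    letters. *)
Definition moveZ (e q : bool) (x : int) : int :=
  (if q then if x == 0 then 1 else if x == 1 then 0 else x
   else if e then x + 1 else x - 1)%R.

Local Notation actZ := (dual_act moveZ 0%R 1%R).
Local Notation actsZ := (dual_acts moveZ 0%R 1%R).
Local Notation runZ := (dual_run moveZ).
Local Notation flipsZ := (flips (0%R : int) 1%R).

Lemma moveZK e q : cancel (moveZ e q) (moveZ (~~ e) q).
Proof. by rewrite /moveZ => x; case: q e => [] [] /=; do ?case: eqP; lia. Qed.

Lemma moveZ_zo q : moveZ true q 0%R = 1%R.
Proof. by case: q. Qed.

(* [pos false] is the reflection which exchanges generators and inverses. *)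
Definition pos (e : bool) (y : int) : int := (if e then y else 1 - y)%R.

Lemma moveZ_pos c q e y : moveZ c q (pos e y) = pos e (moveZ (c == e) q y).
Proof.
by rewrite /moveZ /pos; case: q c e => [] [] [] /=; do ?case: eqP; lia.
Qed.

(* The fastest way up (down if [e] is [false]) with given signs. *)
Definition star (e : bool) (s : seq bool) := [seq (c, c != e) | c <- s].

Lemma star_signs e s : map fst (star e s) = s.
Proof. by rewrite -map_comp map_id. Qed.

Lemma star_reduced e s : reduced (star e s).
Proof.
case: s => //= c s; elim: s c => //= d s IHs c.
by rewrite IHs andbT; case: e c d {IHs} => [] [] [].
Qed.

Lemma runZ_star e s y :
    (y + (count_mem e s)%:Z < 0)%R ->
  runZ (pos e y) (star e s) = pos e (y + (count_mem e s)%:Z)%R.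
Proof.
elim: s y => [|c s IHs] y /=; first by rewrite addr0.
move=> y0; rewrite moveZ_pos IHs.
  congr pos; move: y0; rewrite /moveZ.
  by case: (c == e) => /=; do ?case: eqP; lia.
by move: y0; rewrite /moveZ; case: (c == e) => /=; do ?case: eqP; lia.
Qed.

(** In the coordinate [y], below 0 a sign [e] gains at most one step and the other sign none, so
    arrival at 0 leaves no slack. As the last sign is [e], 0 is not reached before the end. *)
Lemma runZ_eq_pos0 e W y :
    last e (map fst W) = e -> (y <= - (count_mem e (map fst W))%:Z)%R ->
  (runZ (pos e y) W == pos e 0%R) =
  (y == - (count_mem e (map fst W))%:Z)%R && (W == star e (map fst W)).
Proof.
elim: W y => [|[c q] W IHW] y.
  by move=> _ _; rewrite /= andbT /pos; case: e; lia.
case: W IHW => [_ /= -> | l W].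
  rewrite moveZ_pos eqseq_cons xpair_eqE !eqxx /= addn0 /moveZ.
  by rewrite /pos; case: e q => [] [] /=; do ?case: eqP; lia.
set V := l :: W => IHW lastV; have {}lastV : last e (map fst V) = e by [].
have VK : 0 < count_mem e (map fst V).
  rewrite -has_count; apply/hasP; exists e => //=.
  by rewrite -[X in X \in _]lastV /V /= mem_last.
clearbody V.
have -> : runZ (pos e y) ((c, q) :: V) =
          runZ (pos e (moveZ (c == e) q y)) V.
  by rewrite -moveZ_pos.
have -> : (((c, q) :: V) == star e (map fst ((c, q) :: V))) =
          (q == (c != e)) && (V == star e (map fst V)).
  by rewrite [LHS]eqseq_cons xpair_eqE eqxx.
move=> yK; move: {IHW}(fun y => IHW y lastV) VK yK.
rewrite [count_mem _ (_ :: _)]/=.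
move: (count _ _) (V == _) => K t IHW K_gt0 yK.
have yK' : (moveZ (c == e) q y <= - K%:Z)%R.
  by move: yK; rewrite /moveZ; case: q (c == e) => [] [] /=; do ?case: eqP; lia.
rewrite IHW {yK'}//; move: yK; rewrite /moveZ.
by case: q (c == e) t {IHW} => [] [] [] /=; do ?case: eqP; lia.
Qed.

(** * Transitivity on reduced words with given signs *)

Lemma reduced_rcons (I : eqType) (W : seq (bool * I)) l :
  reduced (rcons W l) -> reduced W.
Proof. by case: W => // k W; rewrite /reduced /= rcons_path => /andP[]. Qed.

Lemma reduced_rcons_last (W : seq (bool * bool)) e p q :
    last e (map fst W) != e ->
  reduced (rcons W (e, p)) -> reduced (rcons W (e, q)) -> p = q.
Proof.
case: W => [|k W] /=; first by rewrite eqxx.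
rewrite /reduced /= !rcons_path last_map /= => /negPf->.
by rewrite !implybF => /andP[_ +] /andP[_]; case: (last _ _).2 p q => [] [] [].
Qed.

(** [N] stays fixed in the induction on the length; the bound on [xs] later lets finite alphabets
    imitate the integers. *)
Lemma actsZ_transitive N (U V : seq (bool * bool)) :
    size U <= N -> reduced U -> reduced V -> map fst U = map fst V ->
  exists2 xs, all (fun x : int => `|x|%N <= N.+1) xs & actsZ xs U = V.
Proof.
have [n Un] : exists n, size U = n by exists (size U).
rewrite Un; elim: n U Un V => [|n IHn] U Un V nN redU redV UV.
  by exists [::]; rewrite //= (size0nil Un) in UV *; case: V UV {redV}.
case/lastP: U => [//|U [e p]] in Un redU UV *.
case/lastP: V => [|V [d q]] in redV UV *.
  by rewrite map_rcons in UV; case: (map _ U) UV.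
move: Un UV; rewrite size_rcons !map_rcons => -[Un] /rcons_inj[UV ed].
rewrite /= in ed; rewrite -{}ed in redV *.
have {}IHn W W' Wn := IHn W Wn W' (ltnW nN).
have [redU' redV'] := (reduced_rcons redU, reduced_rcons redV).
have [lastU | lastU] := eqVneq (last e (map fst U)) e; last first.
  have [xs xsN xsU] := IHn U V Un redU' redV' UV; exists xs => //.
  have [c xsc] := dual_acts_rcons moveZ 0%R 1%R xs U e.
  have := dual_acts_reduced moveZK moveZ_zo xs redU.
  rewrite xsc xsU => redV2; congr (rcons _ (_, _)).
  by apply: reduced_rcons_last redV2 redV; rewrite -UV.
(* The route goes from [U] to [S], around a loop at [S] if the last generator would come out wrong,
   then to [V]. *)
set S := star e (map fst U); pose x := pos e (- (count_mem e (map fst U))%:Z)%R.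
have redS : reduced S := star_reduced _ _.
have signsS : map fst S = map fst U := star_signs _ _.
have sizeS : size S = n by rewrite -(size_map fst) signsS size_map.
have [xs xsN xsU] := IHn U S Un redU' redS (esym signsS).
have [ys ysN ysS] := IHn S V sizeS redS redV' (etrans signsS UV).
have [c xsc] := dual_acts_rcons moveZ 0%R 1%R xs U e.
have [d' ysd] := dual_acts_rcons moveZ 0%R 1%R ys S e.
have [m mx] : exists m, forall q,
    actsZ (nseq m x) (rcons S (e, q)) = rcons S (e, ~~ q).
  apply: dual_loop => W; rewrite signsS => WU.
  (* The letter flipping a sign [e] is 0 or 1 according to [e], that is [pos e 0]. *)
  have -> : flipsZ e (runZ x W) = (runZ x W == pos e 0%R) by case: (e).
  by rewrite runZ_eq_pos0 WU // eqxx.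
have xN : `|x|%N <= N.+1.
  have := count_size (pred1 e) (map fst U); rewrite size_map Un /x /pos.
  by case: e {x lastU S redS signsS sizeS xsU ysS xsc ysd mx} redU redV; lia.
pose k := if (p (+) c) (+) d' == q then 0 else m.
exists (xs ++ nseq k x ++ ys).
  by rewrite !all_cat xsN ysN all_nseq xN orbT.
rewrite !dual_acts_cat xsc xsU /k; case: eqP => [<- | /eqP pq] /=.
  by rewrite ysd ysS.
rewrite mx ysd ysS; congr (rcons _ (_, _)).
by move: pq; case: (p) (c) (d') (q) => [] [] [] [].
Qed.
(* The head of [W] acts first. *)
Fixpoint eval (I : Type) (G : groupType) (g : I -> G) (W : seq (bool * I)) : G :=
  (if W is l :: W' then eval g W' * (if l.1 then g l.2 else (g l.2)^-1)
   else 1)%g.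

(** * Automaton functions at each level and comparison with the integers *)

Section Words.
Variable X : alphabet.

Definition whead k (w : word X k) : option (X k) :=
  match w with wnil k => None | wcons k x _ => Some x end.

Definition wtail k (w : word X k) : word X k.+1 :=
  match w in word _ k return word X k.+1 with
  | wnil k => wnil X k.+1 | wcons k _ w' => w'
  end.

Lemma wcons_inj k (x y : X k) (v w : word X k.+1) :
  wcons x v = wcons y w -> x = y /\ v = w.
Proof.
move=> e; split; last exact: (congr1 (@wtail k) e).
by case: (congr1 (@whead k) e).
Qed.

End Words.

Section Levels.
Variables (r : nat -> nat) (r_gt1 : forall i, 1 < r i).

Let invA := automaton_ab_invertible r_gt1.

Definition state_of (q : bool) : state := if q then state_b else state_a.

Definition level_sym k (q : bool) : sym (word (ord_alphabet r_gt1) k) :=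
  Defs.Sym (aut_fun_bij invA k (state_of q)).

Definition letter_perm k (q : bool) : {perm 'I_(r k)} :=
  if q then tau r_gt1 k else sigma r k.

Definition move k (e q : bool) (x : 'I_(r k)) : 'I_(r k) :=
  if e then letter_perm k q x else (letter_perm k q)^-1%g x.

Local Notation act k :=
  (dual_act (move (k := k)) (letter1 r_gt1 k) (letter2 r_gt1 k)).
Local Notation run k := (dual_run (move (k := k))).

Lemma moveK k e q : cancel (@move k e q) (move (~~ e) q).
Proof. by case: e => x; rewrite /move /= (permK, permKV). Qed.

Lemma move_letter1 k q : move true q (letter1 r_gt1 k) = letter2 r_gt1 k.
Proof.
rewrite /move; case: q => /=; first by rewrite tpermL.
by apply: val_inj; rewrite permE /= modn_small.
Qed.

Lemma level_sym_wcons k q (x : 'I_(r k)) w :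
  level_sym k q (wcons (x : ord_alphabet r_gt1 k) w) =
  wcons (letter_perm k q x : ord_alphabet r_gt1 k)
    (level_sym k.+1 (q (+) (x == letter1 r_gt1 k)) w).
Proof. by case: q => /=; rewrite /trans_ab /out_ab /=; case: eqP. Qed.

(** Both generators map the first letter to the second, so their inverses change state at the
    second. *)
Lemma level_symV_wcons k q (x : 'I_(r k)) w :
  (level_sym k q)^-1%g (wcons (x : ord_alphabet r_gt1 k) w) =
  wcons (move false q x : ord_alphabet r_gt1 k)
    ((level_sym k.+1 (q (+) (x == letter2 r_gt1 k)))^-1%g w).
Proof.
have symVK i (f : sym (word (ord_alphabet r_gt1) i)) : cancel f (f^-1)%g.
  by move=> v; exact: (congr1 (fun h : sym _ => h v) (mulVg f)).
have symK i (f : sym (word (ord_alphabet r_gt1) i)) : cancel (f^-1)%g f.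
  by move=> v; exact: (congr1 (fun h : sym _ => h v) (mulgV f)).
apply: (can_inj (symVK _ (level_sym k q))).
rewrite symK level_sym_wcons (moveK false q x : letter_perm k q _ = x).
have -> : (move false q x == letter1 r_gt1 k) = (x == letter2 r_gt1 k).
  by rewrite -(inj_eq (can_inj (@moveK k true q))) (@moveK k false) move_letter1.
by rewrite symK.
Qed.

Lemma eval_wcons k W (x : 'I_(r k)) w :
  sym_fun (eval (level_sym k) W) (wcons (x : ord_alphabet r_gt1 k) w) =
  wcons (run k x W : ord_alphabet r_gt1 k)
    (sym_fun (eval (level_sym k.+1) (act k x W)) w).
Proof.
elim: W x w => [//|[e q] W IHW] x w.
rewrite -[LHS]/(sym_fun (eval _ W) (sym_fun (if e then _ else _) _)).
by case: e; rewrite (level_sym_wcons, level_symV_wcons) IHW.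
Qed.

Lemma eval1_section k W (x : 'I_(r k)) :
    eval (level_sym k) W = 1%g ->
  run k x W = x /\ eval (level_sym k.+1) (act k x W) = 1%g.
Proof.
move=> W1.
have W1x w : x = run k x W /\ w = sym_fun (eval (level_sym k.+1) (act k x W)) w.
  by have := eval_wcons W x w; rewrite W1 => /wcons_inj.
split; first by have [] := W1x (wnil _ _).
by apply: symP => w; have [_ <-] := W1x w.
Qed.

Lemma eval1_level k (W : seq (bool * bool)) :
    reduced W -> eval (level_sym 0) W = 1%g ->
  exists V : seq (bool * bool),
    [/\ reduced V, size V = size W & eval (level_sym k) V = 1%g].
Proof.
move=> redW W1; elim: k => [|k [V [redV sV /eval1_section V1]]].
  by exists W.
exists (act k (letter1 r_gt1 k) V).
split; last by have [] := V1 (letter1 r_gt1 k).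
  exact: dual_act_reduced (@moveK k) (@move_letter1 k) _ _ redV.
by rewrite dual_act_size.
Qed.

(** For [|x| < r k] this is the residue of [x]: negative integers sit at the top of the alphabet. *)
Definition toI k (x : int) : 'I_(r k) :=
  insubd (letter1 r_gt1 k) `|if (0 <= x)%R then x else ((r k)%:Z + x)%R|%N.

Lemma val_toI k x : `|x| < r k ->
  toI k x = `|if (0 <= x)%R then x else ((r k)%:Z + x)%R|%N :> nat.
Proof. by move=> xr; rewrite val_insubd ifT //; case: ifP; lia. Qed.

Lemma flips_toI k x e : `|x| + 1 < r k ->
  flips (letter1 r_gt1 k) (letter2 r_gt1 k) e (toI k x) = flipsZ e x.
Proof.
move=> xr; rewrite /flips -(inj_eq (@ord_inj _)) val_toI; last by lia.
by case: e => /=; case: ifP; lia.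
Qed.

Lemma letter_perm_toI k x q : `|x| + 1 < r k ->
  letter_perm k q (toI k x) = toI k (moveZ true q x).
Proof.
move=> xr; rewrite /moveZ; case: q => /=; last first.
  apply: val_inj; rewrite permE /= !val_toI; [|lia|lia].
  (* Only -1, placed at the top letter, makes the cycle wrap around. *)
  have [-> | x1] := eqVneq x (-1)%R; last first.
    by rewrite modn_small; do ?case: ifP; lia.
  by rewrite [X in X %% _](_ : _ = r k) ?modnn /=; lia.
have [-> | x0] := eqVneq x 0%R.
  suff [-> ->] : toI k 0%R = letter1 r_gt1 k /\ toI k 1%R = letter2 r_gt1 k.
    exact: tpermL.
  by split; apply: val_inj; rewrite /= val_toI //; have := r_gt1 k; lia.
have [-> | x1] := eqVneq x 1%R.
  suff [-> ->] : toI k 0%R = letter1 r_gt1 k /\ toI k 1%R = letter2 r_gt1 k.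
    exact: tpermR.
  by split; apply: val_inj; rewrite /= val_toI //; have := r_gt1 k; lia.
by rewrite tpermD // -(inj_eq (@ord_inj _)) /= val_toI; do ?case: ifP; lia.
Qed.

Lemma dual_toI k x W : `|x| + (size W).+1 < r k ->
  act k (toI k x) W = actZ x W /\ run k (toI k x) W = toI k (runZ x W).
Proof.
apply: (dual_act_morph (ok := fun x n => `|x| + n.+1 < r k)) => {}x n e.
- by move=> xr; apply: flips_toI; lia.
- case: e => [] q xr; first by apply: letter_perm_toI; lia.
  apply: (canLR (permK _)); rewrite letter_perm_toI.
    by rewrite (moveZK false).
  by rewrite /moveZ; case: q => /=; do ?case: eqP; lia.
- by move=> q; rewrite /moveZ; case: q e => [] [] /=; do ?case: eqP; lia.
Qed.

(** Each letter of [xs] uses up one level, hence the bound on [r] at all levels from [k] on. *)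
Lemma eval1_acts N k W xs :
    (forall i, k <= i -> N.+1 + (size W).+1 < r i) ->
    all (fun x : int => `|x|%N <= N.+1) xs ->
  eval (level_sym k) W = 1%g ->
  exists2 i, k <= i & eval (level_sym i) (actsZ xs W) = 1%g.
Proof.
elim: xs k W => [|x xs IHxs] k W rN /=; first by exists k.
case/andP=> xN xsN /(eval1_section (toI k x))[_].
have [|-> _] := @dual_toI k x W.
  by have := rN k (leqnn k); lia.
case/IHxs => //; first by move=> i ki; rewrite dual_act_size rN // ltnW.
by move=> i ki; exists i; rewrite // ltnW.
Qed.

Hypothesis r_nondecreasing : forall i j : nat, i <= j -> r i <= r j.
Hypothesis r_unbounded : forall N : nat, exists i : nat, N < r i.

Lemma reduced_eval_neq1 (W : seq (bool * bool)) :
  reduced W -> eval (level_sym 0) W = 1%g -> W = [::].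
Proof.
move=> redW W1; apply: size0nil; apply/eqP; apply: contraT.
(* Room for letters of absolute value up to [size W + 2] to pass through a word of length
   [size W]. *)
have [k rk] := r_unbounded (2 * size W + 6).
have [V [redV sizeV V1]] := eval1_level k redW W1.
rewrite -sizeV size_eq0; case defV: {1}V => [//|[e q] V'] _.
pose s := map fst V; pose n := count_mem e s.
have n_gt0 : 0 < n by rewrite /n /s defV /= eqxx.
have nV : n <= size V by rewrite -[size V](size_map fst) count_size.
have rV i : k <= i -> 2 * size V + 6 < r i.
  by move=> /r_nondecreasing; apply: leq_trans; rewrite sizeV.
have [xs xsV xsVS] := actsZ_transitive (leqnn _) redV (star_reduced e s)
  (esym (star_signs e s)).
have [|i ki] := eval1_acts _ xsV V1; first by move=> i /rV; lia.
(* From this start the [n] steps end at -1, still below 0, and [n > 0] makes the letter move. *)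
rewrite {}xsVS; set y : int := (- n.+1%:Z)%R.
have yn : (y + n%:Z = -1)%R by rewrite /y; lia.
have sizeS : size (star e s) = size V by rewrite !size_map.
have ri := rV i ki.
case/(eval1_section (toI i (pos e y))) => + _.
have [|_ ->] := @dual_toI i (pos e y) (star e s).
  by rewrite sizeS /pos /y; case: (e); lia.
rewrite runZ_star yn // => /(congr1 (@nat_of_ord _)).
by rewrite !val_toI /pos /y; case: (e) => /=; do ?case: ifP; lia.
Qed.

End Levels.

(** * From the absence of reduced relations to the universal property *)

Section FreeGeneration.
Local Open Scope group_scope.

Lemma eval_cat I (G : groupType) (g : I -> G) U V :
  eval g (U ++ V) = eval g V * eval g U.
Proof. by elim: U => [|l U IHU] /=; rewrite ?mulg1 // IHU mulgA. Qed.

Definition word_inv I (W : seq (bool * I)) := rev [seq (~~ l.1, l.2) | l <- W].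

Lemma eval_inv I (G : groupType) (g : I -> G) W :
  eval g (word_inv W) = (eval g W)^-1.
Proof.
elim: W => [|[e i] W IHW] /=; first by rewrite invg1.
rewrite /word_inv /= rev_cons -cats1 eval_cat IHW /= mul1g invgM.
by case: e; rewrite ?invgK.
Qed.

Lemma eval_morph I (G H : groupType) (phi : {multiplicative G -> H})
    (g : I -> G) W : phi (eval g W) = eval (phi \o g) W.
Proof.
have phi1 : phi 1 = 1 by apply: (mulgI (phi 1)); rewrite -gmulfM !mulg1.
have phiV x : phi x^-1 = (phi x)^-1.
  by apply: (mulgI (phi x)); rewrite -gmulfM !mulgV.
by elim: W => //= -[e i] W IHW; rewrite gmulfM IHW; case: e; rewrite //= phiV.
Qed.

Lemma not_reduced (I : eqType) (W : seq (bool * I)) : ~~ reduced W ->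
  exists U V e i, W = U ++ (e, i) :: (~~ e, i) :: V.
Proof.
elim: W => // -[e i] [|[d j] W] //= IHW; rewrite negb_and => /orP[|/IHW].
  rewrite negb_imply => /andP[/= /eqP<- ed]; exists [::], W, e, i.
  by case: e d ed {IHW} => [] [].
by move=> [U [V [c [k ->]]]]; exists ((e, i) :: U), V, c, k.
Qed.

(** Cancelling adjacent inverse letters changes neither value and ends at a reduced word, which must
    be empty. *)
Lemma eval1_transfer (I : eqType) (G H : groupType) (g : I -> G) (f : I -> H) W :
    (forall V, reduced V -> eval g V = 1 -> V = [::]) ->
  eval g W = 1 -> eval f W = 1.
Proof.
move=> gfree; have [n] := ubnP (size W); elim: n W => // n IHn W.
have [redW _ /(gfree _ redW)-> // |] := boolP (reduced W).
case/not_reduced=> U [V [e [i ->]]].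
have cancel (K : groupType) (k : I -> K) :
    eval k (U ++ (e, i) :: (~~ e, i) :: V) = eval k (U ++ V).
  by rewrite !eval_cat /= -!mulgA; case: (e) => /=; rewrite (mulKg, mulVKg).
rewrite !cancel size_cat /= => Wn; apply: IHn.
by rewrite size_cat; lia.
Qed.

(** The extension evaluates [f] on a chosen word; two words for one element differ by a relation,
    which also holds in [H]. *)
Lemma freely_generated_of_reduced (I : eqType) (G : groupType) (g : I -> G) :
    (forall x, exists W, eval g W = x) ->
    (forall W, reduced W -> eval g W = 1 -> W = [::]) ->
  freely_generated g.
Proof.
move=> gen gfree H f; pose phi x := eval f (sval (cid (gen x))).
have phiE W : phi (eval g W) = eval f W.
  rewrite /phi; case: cid => V /= VW; apply: (mulgI (eval f W)^-1).
  rewrite mulVg -eval_inv -eval_cat; apply: eval1_transfer gfree _.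
  by rewrite eval_cat eval_inv VW mulVg.
have phiM : {morph phi : x y / x * y}.
  move=> x y; have [[U <-] [V <-]] := (gen x, gen y).
  by rewrite -eval_cat !phiE eval_cat.
pose phi_morph := isMultiplicative.Build G H phi phiM.
pose Phi : {multiplicative G -> H} := HB.pack phi phi_morph.
exists Phi => [i | psi psi_g x].
  by have := phiE [:: (true, i)]; rewrite /= !mul1g.
have [W <-] := gen x; rewrite eval_morph /= phiE.
by congr eval; apply: funext.
Qed.

Lemma freely_generated_reindex I J (h : J -> I) (G : groupType) (g : I -> G) :
  bijective h -> freely_generated g -> freely_generated (g \o h).
Proof.
move=> [k hK kK] gfree H f; have [phi phi_g uniq_phi] := gfree H (f \o k).
exists phi => [j | psi psi_g]; first by rewrite phi_g /= hK.
by apply: uniq_phi => i; rewrite -[i in LHS]kK; exact: psi_g.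
Qed.

Lemma gen_group_eval I (G : groupType) (g : I -> G) (x : gen_group g) :
  exists W, eval (gen_elt g) W = x.
Proof.
suff [W Wx] : exists W, eval g W = val x.
  exists W; apply: val_inj; rewrite -Wx.
  exact: (eval_morph (val : {multiplicative gen_group g -> G})).
pose values := [set y | exists W, eval g W = y]%classic.
case: x => x /= /set_mem.
apply: (@smallest_sub _ _ _ values) => [|_ [i _ <-]]; last first.
  by exists [:: (true, i)]; rewrite /= mul1g.
split; first by apply/mem_set; exists [::].
move=> _ _ /set_mem[U <-] /set_mem[V <-]; apply/mem_set.
(* The head acts first, so the inverse, the right factor of the quotient, comes first in the
   word. *)
by exists (word_inv V ++ U); rewrite eval_cat eval_inv.
Qed.

End FreeGeneration.

Theorem theorem1 (r : nat -> nat) (r_gt1 : forall i : nat, 1 < r i)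
    (r_nondecreasing : forall i j : nat, i <= j -> r i <= r j)
    (r_unbounded : forall N : nat, exists i : nat, N < r i) :
  let invA := automaton_ab_invertible r_gt1 in
  freely_generated (aut_gen invA) /\ free_group_of_rank 2 (aut_group invA).
Proof.
move=> invA.
have state_bij : bijective state_of.
  exists (fun s => if s is state_b then true else false); first by case.
  by case.
have [name nameK Kname] := state_bij.
have free : freely_generated (aut_gen invA \o state_of).
  apply: freely_generated_of_reduced => [x | W redW /(congr1 val) W1].
    have [W Wx] := gen_group_eval x; exists [seq (l.1, name l.2) | l <- W].
    by rewrite -{}Wx; elim: W => //= l W ->; rewrite Kname.
  (* [val] is a morphism carrying the generators to [level_sym 0]. *)
  apply: (reduced_eval_neq1 r_nondecreasing r_unbounded redW (r_gt1 := r_gt1)).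
  by rewrite -[RHS]W1 [RHS]eval_morph.
have free_state : freely_generated (aut_gen invA).
  have -> : aut_gen invA = (aut_gen invA \o state_of) \o name.
    by apply: funext => s /=; rewrite Kname.
  by apply: freely_generated_reindex free; exists state_of.
split=> //; exists ((aut_gen invA \o state_of) \o (fun i : 'I_2 => i == ord0)).
apply: freely_generated_reindex free.
exists (fun b : bool => if b then ord0 else ord_max) => [i | []] //.
by apply: val_inj; case: i => [] [|[|]].
Qed.
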